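(* (1) Let $\sigma\in S_p$ and $\tau\in S_q$. Then the Heisenberg product in $\Bbbk S_\infty$ can be expressed as $$\sigma\#\tau=\sum_{n=\max(p,q)}^{p+q}\ \sum_{\substack{\xi\in\mathrm{Sh}(p,n-p)\\ \eta\in\mathrm{Sh}(p+q-n,n-q)}}\xi\,\bigl((\sigma\eta)\times\mathrm{Id}_{n-p}\bigr)\,\beta_{2n-p-q,\,p+q-n}\,(\mathrm{Id}_{n-q}\times\tau).$$ (2) When $n=p+q$, the degree $n$ component is $$(\sigma\#\tau)_n=\sigma\star\tau=\sum_{\xi\in\mathrm{Sh}(p,q)}\xi(\sigma\times\tau),$$ and when $n=p=q$, $(\sigma\#\tau)_n=\sigma\tau$.
   Context: Let $\Bbbk$ be a field of characteristic zero and $\Bbbk S_\infty=\bigoplus_{n\ge0}\Bbbk S_n$ the direct sum of all symmetric group algebras. For permutations in the same $S_n$, $\sigma\tau$ denotes the usual composition, $(\sigma\tau)(i)=\sigma(\tau(i))$; $\mathrm{Id}_n$ is the identity of $S_n$. For $\sigma\in S_p$, $\tau\in S_q$, the permutation $\sigma\times\tau\in S_{p+q}$ is given by $(\sigma\times\tau)(i)=\sigma(i)$ for $1\le i\le p$ and $(\sigma\times\tau)(i)=p+\tau(i-p)$ for $p+1\le i\le p+q$. $\mathrm{Sh}(p,q)$ is the set of $\xi\in S_{p+q}$ with $\xi(1)<\cdots<\xi(p)$ and $\xi(p+1)<\cdots<\xi(p+q)$. $\beta_{p,q}\in S_{p+q}$ is the $(p,q)$-shuffle of maximal length: $\beta_{p,q}(i)=q+i$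 for $1\le i\le p$ and $\beta_{p,q}(p+i)=i$ for $1\le i\le q$. Let $V$ be a finite-dimensional vector space and $T(V)=\bigoplus_{n\ge0}V^{\otimes n}$ its tensor algebra, a graded connected Hopf algebra with concatenation product and with the elements of $V$ primitive. The group $GL(V)$ acts diagonally on each $V^{\otimes n}$; let $\mathrm{End}_{\mathrm{gr},GL(V)}(T(V))$ be the space of degree-preserving linear endomorphisms of $T(V)$ commuting with $GL(V)$. Let $\Psi:\Bbbk S_\infty\to\mathrm{End}_{\mathrm{gr},GL(V)}(T(V))$ be the linear map sending $\sigma\in S_n$ to the endomorphism which is $v_1\cdots v_n\mapsto v_{\sigma(1)}\cdots v_{\sigma(n)}$ on $V^{\otimes n}$ and $0$ on the other homogeneous components; $\Psi$ is taken, by Schur–Weyl duality, to be a homogeneous isomorphism of vector spaces. On endomorphisms of a Hopf algebra, the Heisenberg product is $(f\#g)(h)=\sum f(h_1)_2\,g(h_2f(h_1)_1)$ (Sweedler notation) and the convolution product is $(f\star g)(h)=\sum f(h_1)g(h_2)$. Both restrict to $\mathrm{End}_{\mathrm{gr},GL(V)}(T(V))$. The Heisenberg product $\#$ on $\Bbbk S_\infty$ is defined by transport along $\Psi$, i.e. by $\Psi(u\#w)=\Psi(u)\#\Psi(w)$ for all $u,w\in\Bbbk S_\infty$. The Malvenuto–Reutenauer product $\star$ on $\Bbbk S_\infty$ is the one corresponding in the same way to the convolution product. *)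

(* Defs.v *)
From HB Require Import structures.
From mathcomp Require Import all_boot all_algebra all_fingroup.
From mathcomp Require Import finmap.
From mathcomp Require Export monalg.
From Stdlib Require Export ClassicalEpsilon.

Set Implicit Arguments.
Unset Strict Implicit.
Unset Printing Implicit Defensive.

Import GRing.Theory.
Local Open Scope ring_scope.

(** * Permutations *)

(* mathcomp's product of permutations is (s * t) i = t (s i); the convention
   used here is (s \oS t) i = s (t i). *)
Definition compS n (s t : 'S_n) : 'S_n := (t * s)%g.
Notation "s \oS t" := (compS s t) (at level 40, left associativity).

Lemma compSE n (s t : 'S_n) i : (s \oS t) i = s (t i).
Proof. exact: permM. Qed.

(* Total version of [cast_perm]: moves a permutation between 'S_m and 'S_n when
   m and n are equal but not convertible. The value 1 for m != n is junk. *)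
Definition castS n m (s : 'S_m) : 'S_n :=
  if m =P n is ReflectT e then cast_perm e s else 1%g.

Lemma castSE n m (e : m = n) (s : 'S_m) : castS n s = cast_perm e s.
Proof.
by rewrite /castS; case: eqP => // e'; congr cast_perm; apply: eq_irrelevance.
Qed.

Section CrossBeta.
Variables p q : nat.

Definition cross_fun (s : 'S_p) (t : 'S_q) (i : 'I_(p + q)) : 'I_(p + q) :=
  match split i with inl j => lshift q (s j) | inr j => rshift p (t j) end.

Lemma cross_inj s t : injective (cross_fun s t).
Proof.
move=> i j; rewrite /cross_fun.
case: (split_ordP i) => i' ->; case: (split_ordP j) => j' -> /eqP;
  rewrite ?eq_lrshift ?eq_rlshift // ?eq_lshift ?eq_rshift => /eqP/perm_inj -> //.
Qed.

Definition cross (s : 'S_p) (t : 'S_q) : 'S_(p + q) := perm (@cross_inj s t).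

Lemma crossl s t (i : 'I_p) : cross s t (lshift q i) = lshift q (s i).
Proof. by rewrite permE /cross_fun (unsplitK (inl i)). Qed.

Lemma crossr s t (i : 'I_q) : cross s t (rshift p i) = rshift p (t i).
Proof. by rewrite permE /cross_fun (unsplitK (inr i)). Qed.

Definition beta_fun (i : 'I_(p + q)) : 'I_(p + q) :=
  cast_ord (addnC q p)
    match split i with inl j => rshift q j | inr j => lshift p j end.

Lemma beta_inj : injective beta_fun.
Proof.
move=> i j; rewrite /beta_fun => /cast_ord_inj.
case: (split_ordP i) => i' ->; case: (split_ordP j) => j' -> /eqP;
  rewrite ?eq_lrshift ?eq_rlshift // ?eq_lshift ?eq_rshift => /eqP -> //.
Qed.

Definition beta : 'S_(p + q) := perm beta_inj.

Lemma betal (i : 'I_p) : beta (lshift q i) = (q + i)%N :> nat.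
Proof. by rewrite permE /beta_fun (unsplitK (inl i)). Qed.

Lemma betar (i : 'I_q) : beta (rshift p i) = i :> nat.
Proof. by rewrite permE /beta_fun (unsplitK (inr i)). Qed.

Definition Sh : {set 'S_(p + q)} :=
  [set xi : 'S_(p + q) |
    [forall i : 'I_p, forall j : 'I_p,
       (i < j)%N ==> (xi (lshift q i) < xi (lshift q j))%N]
    && [forall i : 'I_q, forall j : 'I_q,
       (i < j)%N ==> (xi (rshift p i) < xi (rshift p j))%N]].

End CrossBeta.

(** * Linear extension from a basis *)

Section LinExt.
Variables (k : fieldType) (K : choiceType) (M : lmodType k).

(* The linear map {malg k[K]} -> M that sends the basis element << x >> to
   f x. *)
Definition linext (f : K -> M) (u : {malg k[K]}) : M :=
  \sum_(x <- msupp u) u@_x *: f x.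

Lemma linextEw (f : K -> M) (d : {fset K}) u :
  (msupp u `<=` d)%fset -> linext f u = \sum_(x <- d) u@_x *: f x.
Proof.
move=> sub; apply: big_fset_incl => // x _.
by move/mcoeff_outdom => ->; rewrite scale0r.
Qed.

Fact linext_is_linear f : linear (linext f).
Proof.
move=> c u v; pose d := (msupp (c *: u + v) `|` (msupp u `|` msupp v))%fset.
rewrite !(@linextEw f d); first last.
- exact: fsubsetUl.
- by rewrite /d fsetUCA fsubsetUl.
- by rewrite /d fsetUA fsubsetUr.
rewrite scaler_sumr -big_split /=; apply: eq_bigr => x _.
by rewrite mcoeffD mcoeffZ scalerDl scalerA.
Qed.

HB.instance Definition _ f :=
  GRing.isLinear.Build k {malg k[K]} M *:%R (linext f) (linext_is_linear f).

Lemma linextU f x : linext f << x >> = f x.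
Proof.
by rewrite /linext msuppU oner_eq0 big_seq_fset1 mcoeffUU scale1r.
Qed.

End LinExt.

(** * The tensor Hopf algebra *)

(* monalg provides {malg k[K]} with its algType structure only when K is
   commutative; otherwise it is just a lalgType, hence the next two lemmas. *)
Section MalgAlgebra.
Variables (k : fieldType) (K : monomType).

Fact malg_scalerAr (c : k) (x y : {malg k[K]}) : c *: (x * y) = x * (c *: y).
Proof.
have sy : (msupp (c *: y) `<=` msupp y)%fset by apply: msuppZ_le.
apply/malgP => m; rewrite mcoeffZ (mcoeffMlw m (fsubset_refl _) sy) mcoeffMl.
rewrite mulr_sumr; apply: eq_bigr => a _; rewrite mulr_sumr.
by apply: eq_bigr => b _; rewrite mcoeffZ mulrnAr mulrCA.
Qed.
End MalgAlgebra.

Lemma linextM (k : fieldType) (K : monomType) (M : lalgType k) (f : K -> M) :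
  (forall (c : k) (x y : M), c *: (x * y) = x * (c *: y)) ->
  {morph f : a b / mmul a b >-> a * b} ->
  {morph linext f : x y / x * y >-> x * y}.
Proof.
move=> scAr fM x y; rewrite malgME linear_sum /=.
rewrite [linext f x]/linext [linext f y]/linext mulr_suml.
apply: eq_bigr => a _; rewrite linear_sum mulr_sumr.
apply: eq_bigr => b _.
have ->: << x@_a * y@_b *g mmul a b >> =
         (x@_a * y@_b) *: << mmul a b >> :> {malg k[K]}.
  by apply/malgP => c; rewrite mcoeffZ !mcoeffU mulrnAr mulr1.
by rewrite linearZ /= linextU fM -scalerA scAr -scalerAl.
Qed.

Section PairMonom.
Variables A B : monomType.
Implicit Types x y : (A * B)%type.

Definition pair_mone : (A * B)%type := (mone, mone).
Definition pair_mmul x y : (A * B)%type := (mmul x.1 y.1, mmul x.2 y.2).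

Fact pair_mmulA : associative pair_mmul.
Proof. by move=> x y z; rewrite /pair_mmul /= !mulmA. Qed.
Fact pair_mmul1m : left_id pair_mone pair_mmul.
Proof. by case=> a b; rewrite /pair_mmul /= !mul1m. Qed.
Fact pair_mmulm1 : right_id pair_mone pair_mmul.
Proof. by case=> a b; rewrite /pair_mmul /= !mulm1. Qed.
Fact pair_munit x y :
  pair_mmul x y = pair_mone -> x = pair_mone /\ y = pair_mone.
Proof.
by case: x y => [a b] [c d] [] /unitm[-> ->] /unitm[-> ->].
Qed.

HB.instance Definition _ := Choice_isMonomialDef.Build (A * B)%type
  pair_mmulA pair_mmul1m pair_mmulm1 pair_munit.
End PairMonom.

Section TensorAlgebra.
Variables (k : fieldType) (V : vectType k).

Definition word := {fmonom 'I_(\dim {:V})}.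

(* T(V), as the free associative algebra on the basis vbasis {:V} of V; its
   product is concatenation and a word of length n is a basis vector of the
   n-th tensor power of V. *)
Definition tens := {malg k[word]}.

(* T(V) (x) T(V), with basis the pairs of words and the componentwise product:
   << (a, b) >> stands for a (x) b. *)
Definition tens2 := {malg k[(word * word)%type]}.

Definition letter (i : 'I_(\dim {:V})) : word := FMonom [:: i].

Definition iota_tens (v : V) : tens :=
  \sum_(i < \dim {:V}) coord (vbasis {:V}) i v *: (<< letter i >> : tens).

(* x |-> x (x) 1 and x |-> 1 (x) x *)
Definition inl_tens : tens -> tens2 :=
  linext (fun a : word => << (a, mone) >> : tens2).
Definition inr_tens : tens -> tens2 :=
  linext (fun a : word => << (mone, a) >> : tens2).

(* The morphism of algebras T(V) -> T(V) (x) T(V) for which the letters are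
   primitive; see [coprod_iota], [coprod1] and [coprodM]. *)
Definition coprod : tens -> tens2 :=
  linext (fun w : word =>
    \prod_(i <- (w : seq _))
      (inl_tens << letter i >> + inr_tens << letter i >>)).

HB.instance Definition _ := GRing.Linear.on inl_tens.
HB.instance Definition _ := GRing.Linear.on inr_tens.
HB.instance Definition _ := GRing.Linear.on coprod.

Lemma mmulE (a b : word) : mmul a b = FMonom (a ++ b).
Proof. exact: fmmulE. Qed.

Lemma coprod1 : coprod 1 = 1.
Proof. by rewrite /coprod linextU fm1 big_nil. Qed.

Lemma coprodM (x y : tens) : coprod (x * y) = coprod x * coprod y.
Proof.
apply: linextM => [c a b|a b]; first exact: malg_scalerAr.
by rewrite mmulE big_cat.
Qed.

Lemma coprod_iota (v : V) :
  coprod (iota_tens v) = inl_tens (iota_tens v) + inr_tens (iota_tens v).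
Proof.
rewrite /iota_tens !linear_sum -big_split /=; apply: eq_bigr => i _.
by rewrite !linearZ /= -scalerDr {1}/coprod linextU big_seq1.
Qed.

(* [sweedler F (coprod h)] is the sum of the F h_1 h_2, for F bilinear. *)
Definition sweedler (F : tens -> tens -> tens) (t : tens2) : tens :=
  linext (fun ab : (word * word)%type => F << ab.1 >> << ab.2 >>) t.

Definition convolution (f g : {linear tens -> tens}) (h : tens) : tens :=
  sweedler (fun h1 h2 => f h1 * g h2) (coprod h).

Definition heisenberg (f g : {linear tens -> tens}) (h : tens) : tens :=
  sweedler (fun h1 h2 =>
    sweedler (fun fh1_1 fh1_2 => fh1_2 * g (h2 * fh1_1)) (coprod (f h1)))
  (coprod h).

End TensorAlgebra.

(** * The space kS_oo and the map Psi *)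

Definition perms : choiceType := {n : nat & 'S_n}.

(* The direct sum of the group algebras kS_n: it has the disjoint union of the
   symmetric groups as a basis. *)
Definition kSoo (k : fieldType) := {malg k[perms]}.

Section SymmetricGroups.
Variable k : fieldType.

Definition inS n (s : 'S_n) : kSoo k := << (Tagged (fun n => 'S_n) s : perms) >>.

Definition component n (u : kSoo k) : kSoo k :=
  linext (fun s : perms => if tag s == n then inS (tagged s) else 0) u.

(* v_1 ... v_n |-> v_s(1) ... v_s(n) on words of length n, and 0 on the words
   of any other length. *)
Definition act_word (V : vectType k) n (s : 'S_n) (w : word V) : tens V :=
  if insub (w : seq _) is Some t
  then << FMonom [tuple tnth (t : n.-tuple _) (s i) | i < n] >> else 0.

Definition Psi (V : vectType k) (u : kSoo k) : tens V -> tens V :=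
  linext (fun w : word V =>
    linext (fun s : perms => act_word (tagged s) w) u).

HB.instance Definition _ V u := GRing.Linear.on (@Psi V u).

End SymmetricGroups.

Arguments inS k {n} s.

Section PsiTheory.
Variable k : fieldType.

Lemma Psi_word (V : vectType k) n (s : 'S_n) (w : n.-tuple 'I_(\dim {:V})) :
  Psi (inS k s) (<< FMonom w >> : tens V)
    = << FMonom [tuple tnth w (s i) | i < n] >>.
Proof. by rewrite /Psi /inS !linextU /act_word /= valK. Qed.

Lemma prod_letters (V : vectType k) n (c : 'I_n -> k)
    (f : 'I_n -> 'I_(\dim {:V})) :
  \prod_(i < n) (c i *: (<< letter (f i) >> : tens V))
    = (\prod_(i < n) c i) *: << FMonom [tuple f i | i < n] >>.
Proof.
rewrite /= /index_enum -enumT.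
have -> : FMonom (map f (enum 'I_n))
    = \big[@mmul (word V)/mone]_(i <- enum 'I_n) letter (f i).
  elim: (enum 'I_n) => [|i r IH]; rewrite ?big_nil ?big_cons /=.
    exact/esym/fmoneE.
  by rewrite -IH mmulE.
elim: (enum 'I_n) => [|i r IH]; first by rewrite !big_nil scale1r.
rewrite !big_cons IH -scalerAl -malg_scalerAr scalerA; congr (_ *: _).
by rewrite malgM_def fgmulUU mulr1.
Qed.

Lemma prod_iota (V : vectType k) n (v : 'I_n -> V) :
  \prod_(i < n) iota_tens (v i)
    = \sum_(f : {ffun 'I_n -> 'I_(\dim {:V})})
        (\prod_(i < n) coord (vbasis {:V}) (f i) (v i))
          *: (<< FMonom [tuple f i | i < n] >> : tens V).
Proof.
rewrite /iota_tens bigA_distr_bigA; apply: eq_bigr => f _.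
exact: (prod_letters (fun i => coord (vbasis {:V}) (f i) (v i)) f).
Qed.

Lemma Psi_iota (V : vectType k) n (s : 'S_n) (v : 'I_n -> V) :
  Psi (inS k s) (\prod_(i < n) iota_tens (v i))
    = \prod_(i < n) iota_tens (v (s i)).
Proof.
rewrite [X in Psi _ X]prod_iota.
rewrite [RHS](prod_iota (v \o s)).
etransitivity; first exact: linear_sum.
rewrite (reindex_onto (fun f : {ffun 'I_n -> 'I_(\dim {:V})} =>
            [ffun i => f (s^-1 i)%g]) (fun f => [ffun i => f (s i)])); last first.
  by move=> f _; apply/finfun.ffunP=> i; rewrite !ffunE permKV.
rewrite (eq_bigl xpredT) => [|f]; last first.
  by apply/eqP/finfun.ffunP => i; rewrite !ffunE permK.
apply: eq_bigr => f _; etransitivity; first exact: linearZ.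
have -> : \prod_(i < n) coord (vbasis {:V}) ([ffun i => f (s^-1 i)%g] i) (v i)
    = \prod_(i < n) coord (vbasis {:V}) (f i) ((v \o s) i).
  rewrite (reindex_inj (@perm_inj _ s)); apply: eq_bigr => i _.
  by rewrite ffunE permK.
congr (_ *: _); etransitivity; first exact: Psi_word.
congr << FMonom _ >>; congr val; apply: eq_from_tnth => i.
by rewrite !tnth_mktuple ffunE permK.
Qed.

Lemma mcoeff_act_word (V : vectType k) n m (s : 'S_n) (t : 'S_m)
    (a : n.-tuple 'I_(\dim {:V})) :
  injective (tnth a) ->
  (act_word t (FMonom a : word V))@_(FMonom [tuple tnth a (s i) | i < n])
    = (Tagged (fun n => 'S_n) t == Tagged (fun n => 'S_n) s)%:R.
Proof.
move=> a_inj; rewrite -tag_eqE /tag_eq /act_word /=.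
have [emn|nmn] := eqVneq m n; last first.
  by rewrite insubN ?mcoeff0 // size_tuple eq_sym.
case: _ / emn s a a_inj => s a a_inj.
rewrite valK mcoeffU tagged_asE; congr (nat_of_bool _)%:R.
apply/eqP/eqP => [[e]|-> //]; apply/permP => i; apply: a_inj.
have /(congr1 (fun r => tnth r i)) :
    [tuple tnth a (t i) | i < m] = [tuple tnth a (s i) | i < m].
  exact: val_inj.
by rewrite !tnth_mktuple.
Qed.

Lemma Psi_inj (x y : kSoo k) :
  (forall V : vectType k, Psi (V := V) x =1 Psi y) -> x = y.
Proof.
move=> eqxy; apply/malgP => -[n s]; pose V := 'rV[k]_n.
have dimV : \dim {:V} = n by rewrite dimvf /dim /= mul1n.
pose a : n.-tuple 'I_(\dim {:V}) := [tuple cast_ord (esym dimV) i | i < n].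
have a_inj : injective (tnth a).
  by move=> i j; rewrite !tnth_mktuple => /cast_ord_inj.
pose b : word V := FMonom [tuple tnth a (s i) | i < n].
pose S : perms := Tagged (fun n => 'S_n) s.
have coefP (z : kSoo k) : (Psi z (<< FMonom a >> : tens V))@_b = z@_S.
  rewrite /Psi linextU /linext raddf_sum /=.
  have E (u : perms) : (z@_u *: (act_word (tagged u) (FMonom a) : tens V))@_b
      = z@_u * (u == S)%:R.
    by rewrite mcoeffZ; case: u => m t; rewrite mcoeff_act_word.
  under eq_bigr => u _ do rewrite E.
  case: (msuppP z S) => [sz|sz].
    rewrite (big_fsetD1 _ sz) /= eqxx mulr1 big1_fset ?addr0 // => u.
    by rewrite in_fsetD1 => /andP[/negbTE -> _]; rewrite mulr0.
  rewrite big1_fset // => u; case: eqP => [->|_]; last by rewrite mulr0.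
  by rewrite (negbTE sz).
by move: (coefP x) (coefP y); rewrite eqxy => -> .
Qed.

End PsiTheory.

Section Products.
Variable k : fieldType.

(* Transport of a product of endomorphisms along Psi. For a given V the map Psi
   is injective only in degrees n <= dim V, so the transport equation is imposed
   for all finite-dimensional V at once; by [Psi_inj] it has at most one
   solution. *)
Definition transport
    (op : forall V : vectType k,
       {linear tens V -> tens V} -> {linear tens V -> tens V} ->
       tens V -> tens V)
    (u w : kSoo k) : kSoo k :=
  epsilon (inhabits 0) (fun x : kSoo k =>
    forall V : vectType k, Psi (V := V) x =1 op V (@Psi k V u) (@Psi k V w)).

Definition heisS : kSoo k -> kSoo k -> kSoo k := transport (@heisenberg k).
Definition starS : kSoo k -> kSoo k -> kSoo k := transport (@convolution k).

End Products.

(* Main.v *)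
(* On a basis word w of T(V), the coproduct is the sum over all subsets A of the
   positions of w_A (x) w_{~A}, and the subsets with p elements correspond to
   the (p, q)-shuffles xi by A = {xi(1), ..., xi(p)}. Hence, for w of length n,
   the terms of (Psi sigma # Psi tau)(w) are indexed by the xi in Sh(p, n - p),
   which cuts w, and the eta in Sh(p + q - n, n - q), which cuts the word
   Psi sigma (w_1); lengths force max(p, q) <= n <= p + q. Each term is w read
   along a single permutation. As Psi, taken over all V at once, is injective,
   the formula follows. In degree n = p + q, eta and beta are trivial; for
   n = p = q, all of xi, eta and beta are. *)
Require Import Defs.
From mathcomp Require Import all_boot all_algebra all_fingroup.
From mathcomp Require Import finmap zify.
Import GRing.Theory.
Local Open Scope ring_scope.

Set Implicit Arguments.
Unset Strict Implicit.
Unset Printing Implicit Defensive.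

(** * Increasing enumerations of ordinals and of sets of ordinals *)

Lemma enum_ordD p q :
  enum 'I_(p + q) = map (lshift q) (enum 'I_p) ++ map (@rshift p q) (enum 'I_q).
Proof.
apply: (inj_map (@ord_inj _)); rewrite val_enum_ord map_cat.
rewrite -!(map_comp _ (lshift _)) -!(map_comp _ (@rshift _ _)) iotaD.
congr (_ ++ _); first by rewrite -[in LHS]val_enum_ord; apply: eq_map.
rewrite -[(0 + p)%N]addnC iotaDl -[in LHS]val_enum_ord -map_comp.
exact: eq_map.
Qed.

Lemma codom_ordD (T : Type) p q (f : 'I_(p + q) -> T) :
  codom f = codom (f \o lshift q) ++ codom (f \o @rshift p q).
Proof. by rewrite !codomE enum_ordD map_cat -!map_comp. Qed.

Lemma codom_cast_ord (T : Type) m n (e : m = n) (f : 'I_n -> T) :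
  codom f = codom (f \o cast_ord e).
Proof. by case: _ / e f => f; apply: eq_codom => i /=; rewrite cast_ord_id. Qed.

(** The order is strict, hence irreflexive, so that a sorted list is determined by its elements
    ([irr_sorted_eq]). *)
Definition ord_lt n : rel 'I_n := relpre val ltn.

Lemma ord_lt_trans n : transitive (@ord_lt n).
Proof. by move=> j i l; apply: ltn_trans. Qed.

Lemma ord_lt_irr n : irreflexive (@ord_lt n).
Proof. by move=> i; apply: ltnn. Qed.

Lemma sorted_enum_ord n : sorted (@ord_lt n) (enum 'I_n).
Proof. by rewrite -sorted_map val_enum_ord iota_ltn_sorted. Qed.

Lemma sorted_enum_set n (A : {set 'I_n}) : sorted (@ord_lt n) (enum A).
Proof.
rewrite /enum_mem -enumT.
exact: (sorted_filter (@ord_lt_trans n) _ (sorted_enum_ord n)).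
Qed.

Lemma codom_mono_sorted m n (f : 'I_m -> 'I_n) :
  (forall i j : 'I_m, (i < j)%N -> (f i < f j)%N) ->
  sorted (@ord_lt n) (codom f).
Proof.
move=> fmono; rewrite codomE sorted_map.
by apply: sub_sorted (sorted_enum_ord m) => i j /fmono.
Qed.

Lemma ShP p q (xi : 'S_(p + q)) :
  reflect
    ((forall i j : 'I_p, (i < j)%N -> (xi (lshift q i) < xi (lshift q j))%N)
     /\ (forall i j : 'I_q, (i < j)%N -> (xi (rshift p i) < xi (rshift p j))%N))
    (xi \in Sh p q).
Proof.
rewrite inE; apply: (iffP andP) => -[h1 h2]; split.
- by move=> i j; apply/implyP; apply: (forallP (forallP h1 i)).
- by move=> i j; apply/implyP; apply: (forallP (forallP h2 i)).
- by apply/forallP => i; apply/forallP => j; apply/implyP; apply: h1.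
- by apply/forallP => i; apply/forallP => j; apply/implyP; apply: h2.
Qed.

(** * The bijection between shuffles and sets of [p] positions *)

Section ShuffleSubset.
Variables p q : nat.

Definition shuffle_set (xi : 'S_(p + q)) : {set 'I_(p + q)} :=
  [set xi (lshift q i) | i : 'I_p].

Lemma card_shuffle_set xi : #|shuffle_set xi| = p.
Proof. by rewrite card_imset ?card_ord // => i j /perm_inj/lshift_inj. Qed.

Lemma shuffle_setC xi : ~: shuffle_set xi = [set xi (rshift p i) | i : 'I_q].
Proof.
apply/setP => x; rewrite inE -[x](permKV xi).
case: (split_ordP (xi^-1 x)%g) => j ->.
  rewrite imset_f //=; apply/esym/negbTE/imsetP => -[i _ /perm_inj/eqP].
  by rewrite eq_lrshift.
rewrite [RHS]imset_f //=; apply/imsetP => -[i _ /perm_inj/eqP].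
by rewrite eq_rlshift.
Qed.

(** Both lists are strictly increasing, the right one because [xi] is a shuffle, and they have the
    same elements. *)
Lemma enum_shuffle_set xi : xi \in Sh p q ->
  enum (shuffle_set xi) = codom (fun i : 'I_p => xi (lshift q i)).
Proof.
case/ShP => xil _; apply: (irr_sorted_eq (@ord_lt_trans _) (@ord_lt_irr _)).
- exact: sorted_enum_set.
- exact: (codom_mono_sorted xil).
- move=> x; rewrite mem_enum.
  apply/imsetP/codomP => [[i _ ->]|[i ->]]; by exists i.
Qed.

Lemma enum_shuffle_setC xi : xi \in Sh p q ->
  enum (~: shuffle_set xi) = codom (fun i : 'I_q => xi (rshift p i)).
Proof.
case/ShP => _ xir; apply: (irr_sorted_eq (@ord_lt_trans _) (@ord_lt_irr _)).
- exact: sorted_enum_set.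
- exact: (codom_mono_sorted xir).
- rewrite shuffle_setC => x.
  rewrite mem_enum; apply/imsetP/codomP => [[i _ ->]|[i ->]]; by exists i.
Qed.

(** The increasing enumerations of the set and of its complement recover [xi] on its two blocks. *)
Lemma shuffle_set_inj : {in Sh p q &, injective shuffle_set}.
Proof.
move=> xi zeta Sxi Szeta e; apply/permP => x.
have el := enum_shuffle_set Sxi; have er := enum_shuffle_setC Sxi.
move: el er; rewrite e (enum_shuffle_set Szeta) (enum_shuffle_setC Szeta).
rewrite !codomE => /eq_in_map el /eq_in_map er.
by case: (split_ordP x) => i ->; rewrite ?el ?er ?mem_enum.
Qed.

(** The preimage lists [A] in increasing order on the first block and the complement of [A] on the
    second. *)
Lemma shuffle_set_surj (A : {set 'I_(p + q)}) : #|A| = p ->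
  exists2 xi, xi \in Sh p q & shuffle_set xi = A.
Proof.
move=> cA; have cC : #|~: A| = q.
  by have := cardsC A; rewrite cA card_ord => /addnI.
pose f x := match split x with
  | inl i => enum_val (cast_ord (esym cA) i)
  | inr j => enum_val (cast_ord (esym cC) j) end.
have fl i : f (lshift q i) = enum_val (cast_ord (esym cA) i).
  by rewrite /f (unsplitK (inl i)).
have fr i : f (rshift p i) = enum_val (cast_ord (esym cC) i).
  by rewrite /f (unsplitK (inr i)).
have flA i : f (lshift q i) \in A by rewrite fl enum_valP.
have frA i : f (rshift p i) \notin A by rewrite fr -in_setC enum_valP.
have f_inj : injective f.
  move=> x y; case: (split_ordP x) => i ->; case: (split_ordP y) => j -> e.
  - by move: e; rewrite !fl => /enum_val_inj/cast_ord_inj ->.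
  - by have := frA j; rewrite -e flA.
  - by have := frA i; rewrite e flA.
  - by move: e; rewrite !fr => /enum_val_inj/cast_ord_inj ->.
have mono (B : {set 'I_(p + q)}) (i j : 'I_#|B|) :
    (i < j)%N -> (enum_val i < enum_val j)%N.
  (* [nth] needs a default element, and ['I_(p + q)] may be empty; the index [i] provides one. *)
  move=> ij; have x0 := enum_val i; rewrite !(enum_val_nth x0).
  apply: (sorted_ltn_nth (@ord_lt_trans _)); rewrite ?inE -?cardE //.
  exact: sorted_enum_set.
exists (perm f_inj).
  by apply/ShP; split=> i j ij; rewrite !permE ?fl ?fr; apply: mono.
apply/setP => x; apply/imsetP/idP => [[i _ ->]|xA]; first by rewrite permE.
exists (cast_ord cA (enum_rank_in xA x)) => //.
by rewrite permE fl cast_ordK enum_rankK_in.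
Qed.

(** This turns the sums over subsets produced by the coproduct into sums over shuffles. *)
Lemma big_Sh (M : nmodType) (F : {set 'I_(p + q)} -> M) :
  \sum_(A : {set 'I_(p + q)} | #|A| == p) F A
    = \sum_(xi in Sh p q) F (shuffle_set xi).
Proof.
rewrite -(big_imset _ shuffle_set_inj); apply: eq_bigl => A.
apply/eqP/imsetP => [/shuffle_set_surj[xi Sxi <-]|[xi _ ->]].
  by exists xi.
exact: card_shuffle_set.
Qed.

End ShuffleSubset.


Section LinearExtension.
Variables (k : fieldType) (K : choiceType) (M : lmodType k).

Lemma malg_linear_ext (f g : {linear {malg k[K]} -> M}) :
  (forall x, f << x >> = g << x >>) -> f =1 g.
Proof.
move=> efg u; rewrite (monalgE u) !linear_sum; apply: eq_bigr => x _.
have -> : << u@_x *g x >> = u@_x *: << x >> :> {malg k[K]}.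
  by apply/malgP => y; rewrite mcoeffZ !mcoeffU mulrnAr mulr1.
by rewrite !linearZ /= efg.
Qed.

End LinearExtension.

Section OrdJoin.
Variables (T : Type) (p q : nat).

Definition ord_join (u : 'I_p -> T) (v : 'I_q -> T) (x : 'I_(p + q)) : T :=
  match split x with inl i => u i | inr j => v j end.

Lemma ord_joinl u v i : ord_join u v (lshift q i) = u i.
Proof. by rewrite /ord_join (unsplitK (inl i)). Qed.

Lemma ord_joinr u v j : ord_join u v (rshift p j) = v j.
Proof. by rewrite /ord_join (unsplitK (inr j)). Qed.

Lemma codom_ord_join u v : codom (ord_join u v) = codom u ++ codom v.
Proof.
rewrite codom_ordD; congr (_ ++ _); apply: eq_codom => i /=.
  exact: ord_joinl.
exact: ord_joinr.
Qed.

End OrdJoin.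

(** * Convolution and Heisenberg product on basis words *)

Section TensorWords.
Variables (k : fieldType) (V : vectType k).

(** Words are presented as functions on positions: permutations then act by precomposition
    ([Psi_wd]), and equalities of words are checked pointwise. *)
Definition wd n (w : 'I_n -> 'I_(\dim {:V})) : word V := FMonom (codom w).

Lemma wdP (x : word V) : {n & {w : 'I_n -> 'I_(\dim {:V}) | x = wd w}}.
Proof.
exists (size (x : seq _)), (tnth (in_tuple x)).
by apply: val_inj; rewrite /= codomE map_tnth_enum.
Qed.

Lemma size_wd n (w : 'I_n -> 'I_(\dim {:V})) : size (wd w) = n.
Proof. by rewrite size_codom card_ord. Qed.

Lemma eq_wd n (v w : 'I_n -> 'I_(\dim {:V})) : v =1 w -> wd v = wd w.
Proof. by move=> e; rewrite /wd (eq_codom e). Qed.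

Lemma malgMU (K : monomType) (a b : K) :
  << a >> * << b >> = << mmul a b >> :> {malg k[K]}.
Proof. by rewrite malgM_def fgmulUU mulr1. Qed.

Lemma wdM p q (u : 'I_p -> 'I_(\dim {:V})) (v : 'I_q -> 'I_(\dim {:V})) :
  << wd u >> * << wd v >> = << wd (ord_join u v) >> :> tens V.
Proof. by rewrite malgMU mmulE /= /wd codom_ord_join. Qed.

Lemma Psi_wd n (s : 'S_n) (w : 'I_n -> 'I_(\dim {:V})) :
  Psi (inS k s) (<< wd w >> : tens V) = << wd (w \o s) >>.
Proof.
have -> : wd w = FMonom (mktuple w) by [].
rewrite Psi_word; congr << _ >>; apply: eq_wd => i /=.
by rewrite tnth_mktuple.
Qed.

Lemma Psi_word_neq n (s : 'S_n) (x : word V) : size x != n ->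
  Psi (inS k s) (<< x >> : tens V) = 0.
Proof. by move=> nx; rewrite /Psi /inS !linextU /act_word insubN. Qed.

(** Distributivity expands the product of the sums x (x) 1 + 1 (x) x over the letters x; [A] is the
    set of positions where the left term is chosen. *)
Lemma coprod_wd n (w : 'I_n -> 'I_(\dim {:V})) :
  coprod (<< wd w >> : tens V)
    = \sum_(A : {set 'I_n})
        (<< (FMonom (map w (enum A)) : word V,
             FMonom (map w (enum (~: A))) : word V) >> : tens2 V).
Proof.
rewrite /coprod linextU /= codomE big_map enumT.
rewrite -[Finite.enum _]/(index_enum _) bigA_distr; apply: eq_bigr => A _.
(* Both enumerations become filters of [enum 'I_n], which can then be replaced by an arbitrary list
   for the induction. *)
rewrite [enum A]/enum_mem [enum (~: A)]/enum_mem /index_enum -!enumT.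
elim: (enum 'I_n) => [|i r IH]; first by rewrite big_nil /= -fmoneE.
rewrite big_cons {}IH /= !inE /inl_tens /inr_tens !linextU.
by case: (i \in A); rewrite /= malgMU /mmul /= /pair_mmul /= mul1m mmulE.
Qed.

Section Sweedler.
Variables (F : tens V -> tens V -> tens V) (p : nat).
Hypothesis F_deg : forall a b : word V, size a != p -> F << a >> << b >> = 0.

(** By [F_deg], only the cuts whose left part has length [p] contribute. *)
Lemma sweedler_coprod n (w : 'I_n -> 'I_(\dim {:V})) :
  sweedler F (coprod << wd w >>)
    = \sum_(A : {set 'I_n} | #|A| == p)
        F << FMonom (map w (enum A)) : word V >>
          << FMonom (map w (enum (~: A))) : word V >>.
Proof.
rewrite coprod_wd /sweedler linear_sum [RHS]big_mkcond /=.
apply: eq_bigr => A _; rewrite linextU /=; case: eqP => // /eqP nA.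
by rewrite F_deg // size_map -cardE.
Qed.

Lemma sweedler_coprod_small n (w : 'I_n -> 'I_(\dim {:V})) : (n < p)%N ->
  sweedler F (coprod << wd w >>) = 0.
Proof.
move=> ltnp; rewrite sweedler_coprod big_pred0 // => A.
by apply/negbTE; rewrite neq_ltn (leq_ltn_trans (max_card _)) ?card_ord.
Qed.

Lemma sweedler_coprod_Sh q (w : 'I_(p + q) -> 'I_(\dim {:V})) :
  sweedler F (coprod << wd w >>)
    = \sum_(xi in Sh p q)
        F << wd (w \o xi \o lshift q) >> << wd (w \o xi \o @rshift p q) >>.
Proof.
rewrite sweedler_coprod big_Sh; apply: eq_bigr => xi Sxi.
by rewrite enum_shuffle_set // enum_shuffle_setC // !codomE -!(map_comp w).
Qed.

End Sweedler.

(** A shuffle cuts [w] into the two blocks of [w \o xi]; permuting them separately by [s] and [t]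
    and concatenating is precomposition with [cross s t]. *)
Lemma convolution_wd p q (s : 'S_p) (t : 'S_q)
    (w : 'I_(p + q) -> 'I_(\dim {:V})) :
  convolution (@Psi k V (inS k s)) (@Psi k V (inS k t)) << wd w >>
    = \sum_(xi in Sh p q) << wd (w \o (xi \oS cross s t)) >>.
Proof.
rewrite /convolution (@sweedler_coprod_Sh _ p) => [|a b na]; last first.
  by rewrite /= Psi_word_neq // mul0r.
apply: eq_bigr => xi _ /=; rewrite !Psi_wd wdM.
congr << _ >>; apply: eq_wd => x; rewrite /= compSE.
case: (split_ordP x) => i ->.
  by rewrite ord_joinl /= crossl.
by rewrite ord_joinr /= crossr.
Qed.

Lemma convolution_wd_neq p q n (s : 'S_p) (t : 'S_q)
    (w : 'I_n -> 'I_(\dim {:V})) : n <> (p + q)%N ->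
  convolution (@Psi k V (inS k s)) (@Psi k V (inS k t)) << wd w >> = 0.
Proof.

move=> npq; pose F (a b : tens V) := Psi (inS k s) a * Psi (inS k t) b.
have F_deg (a b : word V) : size a != p -> F << a >> << b >> = 0.
  by move=> na; rewrite /F Psi_word_neq // mul0r.
rewrite -[convolution _ _ _]/(sweedler F _); case: (ltnP n p) => [ltnp|lepn].
  exact: (sweedler_coprod_small F_deg).
have [r en] : exists r, n = (p + r)%N by exists (n - p)%N; rewrite subnKC.
subst n.
rewrite (sweedler_coprod_Sh F_deg) big1 // => xi _.
rewrite /F [X in _ * X]Psi_word_neq ?mulr0 // size_wd.
by apply/eqP => e; apply: npq; rewrite e.
Qed.

(* The summand of the theorem, with r = n - p, a = p + q - n, b = n - q and
   c = 2n - p - q = b + r. *)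
Definition heis_perm p q n a b r c (s : 'S_p) (t : 'S_q)
    (xi : 'S_(p + r)) (eta : 'S_(a + b)) : 'S_n :=
  castS n xi \oS castS n (cross (s \oS castS p eta) (1%g : 'S_r))
    \oS castS n (beta c a) \oS castS n (cross (1%g : 'S_b) t).

(** Write u = u_a u_b for the pieces of lengths a and b, and h for the last [r] letters of
    [w \o xi]. Up to [cross (s \oS eta) 1], the word read is u_a u_b h; [beta] moves u_a to the end,
    giving u_b h u_a, and [t] then permutes h u_a. With all sizes written in a, b and r, only the
    casts of [beta] and of the last [cross] are nontrivial. *)
Lemma wd_heis_perm a b r (s : 'S_(a + b)) (t : 'S_(r + a))
    (xi : 'S_(a + b + r)) (eta : 'S_(a + b))
    (w : 'I_(a + b + r) -> 'I_(\dim {:V})) :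
  let u := w \o xi \o lshift r \o s \o eta in
  << wd (w \o heis_perm _ (b + r) s t xi eta) >>
    = << wd (u \o @rshift a b) >>
      * << wd (ord_join (w \o xi \o @rshift (a + b) r) (u \o lshift b) \o t) >>
    :> tens V.
Proof.
move=> u; rewrite wdM; congr << _ >>; rewrite /wd /=; congr FMonom.
have e : (b + (r + a) = a + b + r)%N by lia.
have e' : (b + r + a = a + b + r)%N by lia.

(* The values of [beta] are restated for positions known only by their numerical value, which
   absorbs the casts. *)
have betal_cast (y : 'I_(a + b + r)) (i : 'I_(b + r)) (z : 'I_(a + b + r)) :
    y = i :> nat -> z = (a + i)%N :> nat ->
    cast_ord e' (beta (b + r) a (cast_ord (esym e') y)) = z.
  move=> yi zi; have -> : cast_ord (esym e') y = lshift a i by apply: val_inj.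
  by apply: val_inj; rewrite /= betal.
have betar_cast (y : 'I_(a + b + r)) (i : 'I_a) (z : 'I_(a + b + r)) :
    y = (b + r + i)%N :> nat -> z = i :> nat ->
    cast_ord e' (beta (b + r) a (cast_ord (esym e') y)) = z.
  move=> yi zi; have -> : cast_ord (esym e') y = rshift (b + r) i.
    exact: val_inj.
  by apply: val_inj; rewrite /= betar.
rewrite (codom_cast_ord e); apply: eq_codom => x /=.
rewrite /heis_perm !compSE (castSE e) (castSE e') !(castSE (erefl _)).
rewrite !cast_permE !cast_ord_id cast_ordK.
(* Three blocks: the first [b] positions read u_b; a later position is sent by [t] either to one of
   the [r] letters of h or to one of the [a] letters of u_a. *)
case: (split_ordP x) => {x} i ->.
  rewrite ord_joinl crossl perm1.
  rewrite (betal_cast _ (lshift r i) (lshift r (rshift a i))) //.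
  by rewrite crossl compSE cast_permE !cast_ord_id.
rewrite ord_joinr crossr /=; case: (split_ordP (t i)) => j ->.
  rewrite ord_joinl /=.
  rewrite (betal_cast _ (rshift b j) (rshift (a + b) j)) ?addnA //=.
  by rewrite crossr perm1.
rewrite ord_joinr /=.
rewrite (betar_cast _ j (lshift r (lshift b j))) //=; last by rewrite addnA.
by rewrite crossl compSE.
Qed.

Lemma heisenberg_wd_sum p q n (s : 'S_p) (t : 'S_q)
    (w : 'I_n -> 'I_(\dim {:V})) : (maxn p q <= n <= p + q)%N ->
  heisenberg (@Psi k V (inS k s)) (@Psi k V (inS k t)) << wd w >>
    = \sum_(xi in Sh p (n - p)) \sum_(eta in Sh (p + q - n) (n - q))
        << wd (w \o heis_perm n (2 * n - p - q) s t xi eta) >>.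
Proof.
rewrite geq_max => /andP[/andP[lepn leqn] len].
(* The bounds on [n] make these three differences exact, and subtraction disappears from the
   sizes. *)
have [a [b [r [ep eq en]]]] : exists a b r,
    [/\ p = a + b, q = r + a & n = a + b + r]%N.
  by exists (p + q - n)%N, (n - q)%N, (n - p)%N; split; lia.
subst p q n.
have -> : (a + b + r - (a + b) = r)%N by lia.
have -> : (a + b + (r + a) - (a + b + r) = a)%N by lia.
have -> : (a + b + r - (r + a) = b)%N by lia.
have -> : (2 * (a + b + r) - (a + b) - (r + a) = b + r)%N by lia.
pose G h2 (x y : tens V) := y * Psi (inS k t) (h2 * x).
pose F (h1 h2 : tens V) := sweedler (G h2) (coprod (Psi (inS k s) h1)).
rewrite -[heisenberg _ _ _]/(sweedler F _).
rewrite (@sweedler_coprod_Sh _ (a + b)) => [|x y nx].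
  apply: eq_bigr => xi _.
  (* The second piece of [w] has length [r] and [t] acts only on words of length [r + a], so the
     inner cut must take exactly [a] letters. *)
  rewrite /F Psi_wd (@sweedler_coprod_Sh _ a) => [|x y nx].
    by apply: eq_bigr => eta _; rewrite /G wdM Psi_wd wd_heis_perm.
  by rewrite /G malgMU mmulE Psi_word_neq ?mulr0 //= size_cat size_wd eqn_add2l.
by rewrite /F Psi_word_neq // /sweedler !linear0.
Qed.

(** If n < p, the outer cut is impossible. Otherwise [t] must receive q - (n - p) of the [p] letters
    permuted by [s]; this number exceeds p when n < q and is negative when n > p + q. *)
Lemma heisenberg_wd_eq0 p q n (s : 'S_p) (t : 'S_q)
    (w : 'I_n -> 'I_(\dim {:V})) : ~~ (maxn p q <= n <= p + q)%N ->
  heisenberg (@Psi k V (inS k s)) (@Psi k V (inS k t)) << wd w >> = 0.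
Proof.
move=> n_out.
pose G h2 (a b : tens V) := b * Psi (inS k t) (h2 * a).
pose F (h1 h2 : tens V) := sweedler (G h2) (coprod (Psi (inS k s) h1)).
have F_deg (a b : word V) : size a != p -> F << a >> << b >> = 0.
  by move=> na; rewrite /F Psi_word_neq // /sweedler !linear0.
rewrite -[heisenberg _ _ _]/(sweedler F _); case: (ltnP n p) => [ltnp|lepn].
  exact: (sweedler_coprod_small F_deg).
have [r en] : exists r, n = (p + r)%N by exists (n - p)%N; rewrite subnKC.
subst n; rewrite (sweedler_coprod_Sh F_deg) big1 // => xi _.
rewrite /F Psi_wd; set h2 := w \o xi \o @rshift p r.
(* If q < r, then G vanishes on all words, so any d > p will do. *)
pose d := if (r <= q)%N then (q - r)%N else p.+1.
have G_deg (a b : word V) : size a != d -> G << wd h2 >> << a >> << b >> = 0.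
  move=> na; rewrite /G malgMU mmulE Psi_word_neq ?mulr0 //= size_cat size_wd.
  by apply: contraNneq na => e; rewrite /d -e leq_addr addKn.
apply: (sweedler_coprod_small G_deg).
by rewrite /d; case: ifP => // lerq; lia.
Qed.

End TensorWords.

(** * From endomorphisms of tensor algebras back to [kSoo] *)

Section Transport.
Variable k : fieldType.

(** The declared linear structure of [Psi] concerns [h]; additivity in the other argument comes from
    exchanging two sums. *)
Lemma Psi_sum (V : vectType k) (I : Type) (r : seq I) (P : pred I)
    (u : I -> kSoo k) (h : tens V) :
  Psi (\sum_(i <- r | P i) u i) h = \sum_(i <- r | P i) Psi (u i) h.
Proof.
have PsiE v : Psi v h =
    \sum_(x <- msupp h)
      h@_x *: linext (fun s : perms => act_word (tagged s) x) v.
  by [].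
rewrite PsiE (eq_bigr _ (fun i _ => PsiE (u i))) exchange_big.
apply: eq_bigr => x _; rewrite -scaler_sumr; congr (_ *: _); exact: linear_sum.
Qed.

(** The existence of the solution [x] makes the chosen element a solution as well, and [Psi_inj]
    identifies the two. *)
Lemma transport_eq
    (op : forall V : vectType k,
       {linear tens V -> tens V} -> {linear tens V -> tens V} ->
       tens V -> tens V)
    (u w x : kSoo k) :
  (forall V : vectType k, Psi (V := V) x =1 op V (@Psi k V u) (@Psi k V w)) ->
  transport op u w = x.
Proof.
move=> xE; apply: Psi_inj => V h; rewrite xE.
rewrite /transport; set P := fun _ => _.
exact: (epsilon_spec (inhabits 0) P (ex_intro _ x xE)).
Qed.

Lemma starS_inS p q (s : 'S_p) (t : 'S_q) :
  starS (inS k s) (inS k t) = \sum_(xi in Sh p q) inS k (xi \oS cross s t).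
Proof.
apply: (transport_eq (op := @convolution k)) => V.
(* [convolution] is a bare function; this composite is convertible to it and visibly linear, so a
   comparison on basis words suffices. *)
pose conv := linext (fun ab : word V * word V =>
  Psi (inS k s) << ab.1 >> * Psi (inS k t) << ab.2 >>) \o @coprod k V.
apply: (malg_linear_ext (g := conv)) => x /=.
rewrite -[RHS]/(convolution (@Psi k V (inS k s)) (@Psi k V (inS k t)) << x >>).
have [n [w ->]] := wdP x; rewrite Psi_sum; case: (n =P (p + q)%N) => [e|npq].
  by subst n; rewrite convolution_wd; apply: eq_bigr => xi _; rewrite Psi_wd.
rewrite convolution_wd_neq // big1 // => xi _.
by rewrite Psi_word_neq // size_wd; apply/eqP.
Qed.

Lemma heisS_inS p q (s : 'S_p) (t : 'S_q) :
  heisS (inS k s) (inS k t) =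
  \sum_(maxn p q <= n < (p + q).+1)
    \sum_(xi in Sh p (n - p)) \sum_(eta in Sh (p + q - n) (n - q))
      inS k (heis_perm n (2 * n - p - q) s t xi eta).
Proof.
apply: (transport_eq (op := @heisenberg k)) => V.
pose heis := linext (fun ab : word V * word V =>
  sweedler (fun a b => b * Psi (inS k t) (<< ab.2 >> * a))
    (coprod (Psi (inS k s) << ab.1 >>))) \o @coprod k V.
apply: (malg_linear_ext (g := heis)) => x /=.
rewrite -[RHS]/(heisenberg (@Psi k V (inS k s)) (@Psi k V (inS k t)) << x >>).
have [n [w ->]] := wdP x; rewrite Psi_sum.
pose T m := \sum_(xi in Sh p (m - p)) \sum_(eta in Sh (p + q - m) (m - q))
  inS k (heis_perm m (2 * m - p - q) s t xi eta).
have PsiT m : Psi (T m) (<< wd w >> : tens V)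
    = \sum_(xi in Sh p (m - p)) \sum_(eta in Sh (p + q - m) (m - q))
      Psi (inS k (heis_perm m (2 * m - p - q) s t xi eta)) << wd w >>.
  by rewrite Psi_sum; apply: eq_bigr => xi _; rewrite Psi_sum.
(* [T m] consists of permutations of degree [m], so on a word of length [n] only [T n] acts. *)
have PsiT0 m : m != n -> Psi (T m) (<< wd w >> : tens V) = 0.
  move=> nm; rewrite PsiT !big1 // => xi _; rewrite big1 // => eta _.
  by rewrite Psi_word_neq // size_wd eq_sym.
case: (boolP (maxn p q <= n <= p + q)%N) => n_in; last first.
  rewrite heisenberg_wd_eq0 // big_nat big1 // => m m_in; apply: PsiT0.
  by apply: contraNneq n_in => <-.
rewrite heisenberg_wd_sum // (bigD1_seq n) ?mem_index_iota ?iota_uniq //=.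
rewrite [X in _ + X]big1 ?addr0; last by move=> m /PsiT0.
rewrite -[X in Psi X _]/(T n) PsiT; apply: eq_bigr => xi _.
by apply: eq_bigr => eta _; apply: Psi_wd.
Qed.

Lemma component_inS m n (s : 'S_m) :
  component n (inS k s) = if m == n then inS k s else 0.
Proof. by rewrite /component linextU. Qed.

Lemma component_sum n (I : Type) (r : seq I) (P : pred I) (u : I -> kSoo k) :
  component n (\sum_(i <- r | P i) u i)
    = \sum_(i <- r | P i) component n (u i).
Proof. exact: linear_sum. Qed.

Lemma component_heisS p q n (s : 'S_p) (t : 'S_q) :
  (maxn p q <= n <= p + q)%N ->
  component n (heisS (inS k s) (inS k t)) =
  \sum_(xi in Sh p (n - p)) \sum_(eta in Sh (p + q - n) (n - q))
    inS k (heis_perm n (2 * n - p - q) s t xi eta).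
Proof.
move=> n_in; rewrite heisS_inS component_sum.
rewrite (bigD1_seq n) ?mem_index_iota ?iota_uniq //=.
rewrite [X in _ + X]big1 => [|m nm]; last first.
  rewrite component_sum big1 // => xi _; rewrite component_sum big1 // => eta _.
  by rewrite component_inS (negbTE nm).
rewrite addr0 component_sum; apply: eq_bigr => xi _.
by rewrite component_sum; apply: eq_bigr => eta _; rewrite component_inS eqxx.
Qed.

End Transport.

(** * The extreme degrees n = p + q and n = p = q *)

Lemma castS_id n (s : 'S_n) : castS n s = s.
Proof.
rewrite (castSE (erefl n)); apply/permP => i.
by rewrite cast_permE !cast_ord_id.
Qed.

Lemma castS1 m n : castS n (1%g : 'S_m) = 1%g.
Proof.
rewrite /castS; case: eqP => // e; apply/permP => i.
by rewrite cast_permE !perm1 cast_ordKV.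
Qed.

Lemma beta_n0 n : beta n 0 = 1%g.
Proof.
apply/permP => x; apply: val_inj; rewrite perm1 /=.
by case: (split_ordP x) => [i ->|[]//]; rewrite betal.
Qed.

Lemma beta_0n n : beta 0 n = 1%g.
Proof.
apply/permP => x; apply: val_inj; rewrite perm1 /=.
by case: (split_ordP x) => [[]//|i ->]; rewrite betar.
Qed.

Lemma one_Sh p q : (1%g : 'S_(p + q)) \in Sh p q.
Proof. by apply/ShP; split=> i j; rewrite !perm1 //= ltn_add2l. Qed.

(** The set attached to any such shuffle is the set of all positions, so injectivity of
    [shuffle_set] leaves only the identity. *)
Lemma Sh_n0 n : Sh n 0 = [set 1%g].
Proof.
apply/setP => xi; rewrite in_set1; apply/idP/eqP => [Sxi|->];
  last exact: one_Sh.
have full zeta : @shuffle_set n 0 zeta = setT.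
  apply/eqP; rewrite eqEcard subsetT card_shuffle_set.
  by rewrite cardsT card_ord addn0 /=.
by apply: shuffle_set_inj => //; rewrite ?one_Sh ?full.
Qed.

Lemma Sh_0n n : Sh 0 n = [set 1%g].
Proof.
apply/setP => xi; rewrite in_set1; apply/idP/eqP => [Sxi|->];
  last exact: one_Sh.
have empty zeta : @shuffle_set 0 n zeta = set0.
  exact: cards0_eq (card_shuffle_set zeta).
by apply: shuffle_set_inj => //; rewrite ?one_Sh ?empty.
Qed.

Lemma compS1 n (s : 'S_n) : s \oS 1%g = s.
Proof. exact: mul1g. Qed.

Lemma comp1S n (s : 'S_n) : 1%g \oS s = s.
Proof. exact: mulg1. Qed.

Lemma crossM p q (s1 s2 : 'S_p) (t1 t2 : 'S_q) :
  cross s1 t1 \oS cross s2 t2 = cross (s1 \oS s2) (t1 \oS t2).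
Proof.
apply/permP => x; rewrite compSE.
by case: (split_ordP x) => i ->; rewrite ?crossl ?crossr compSE.
Qed.

(** Here a = 0, b = p and r = q: [beta] is the identity, and the two crosses multiply to
    [cross s t]. *)
Lemma heis_perm_top p q (s : 'S_p) (t : 'S_q) (xi : 'S_(p + q)) :
  heis_perm (p + q) (p + q) s t xi (1%g : 'S_(0 + p)) = xi \oS cross s t.
Proof.
rewrite /heis_perm !castS_id beta_n0 castS1 !compS1 /compS mulgA.
by rewrite -![(_ * _)%g]/(_ \oS _) crossM compS1 comp1S.
Qed.

(** Here a = p and b = r = 0, so both crosses have an empty identity block. *)
Lemma heis_perm_bot p (s t : 'S_p) :
  heis_perm p 0 s t (1%g : 'S_(p + 0)) (1%g : 'S_(p + 0)) = s \oS t.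
Proof.
rewrite /heis_perm !castS1 beta_0n castS1 !compS1 comp1S; congr (_ \oS _).
  (* [p + 0] is not convertible to [p], so this cast needs a proof; [0 + p] in the other factor is,
     and [erefl] suffices there. *)
  have e : (p + 0 = p)%N by lia.
  rewrite (castSE e); apply/permP => i; rewrite cast_permE.
  have -> : cast_ord (esym e) i = lshift 0 i by apply: val_inj.
  by rewrite crossl; apply: val_inj.
rewrite (castSE (erefl p)); apply/permP => i; rewrite cast_permE !cast_ord_id.
have ri (j : 'I_p) : j = @rshift 0 p j by apply: val_inj.
by rewrite [RHS]ri -(crossr 1%g) -ri.
Qed.

Theorem theorem6p3 (k : fieldType) (char0 : [pchar k] =i pred0) :
  (forall (p q : nat) (sigma : 'S_p) (tau : 'S_q),
     heisS (inS k sigma) (inS k tau) =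
     \sum_(maxn p q <= n < (p + q).+1)
       \sum_(xi in Sh p (n - p)) \sum_(eta in Sh (p + q - n) (n - q))
         inS k (castS n xi
           \oS castS n (cross (sigma \oS castS p eta) (1%g : 'S_(n - p)))
           \oS castS n (beta (2 * n - p - q) (p + q - n))
           \oS castS n (cross (1%g : 'S_(n - q)) tau)))
  /\
  (forall (p q : nat) (sigma : 'S_p) (tau : 'S_q),
     component (p + q)%N (heisS (inS k sigma) (inS k tau))
       = starS (inS k sigma) (inS k tau)
     /\ starS (inS k sigma) (inS k tau)
       = \sum_(xi in Sh p q) inS k (xi \oS cross sigma tau))
  /\
  (forall (p : nat) (sigma tau : 'S_p),
     component p (heisS (inS k sigma) (inS k tau)) = inS k (sigma \oS tau)).
Proof.
split; first exact: heisS_inS.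
split=> [p q sigma tau|p sigma tau].
  split; last exact: starS_inS.
  rewrite starS_inS component_heisS ?geq_max ?leq_addr ?leq_addl ?leqnn //.
  have -> : (p + q - p = q)%N by lia.
  have -> : (p + q - (p + q) = 0)%N by lia.
  have -> : (p + q - q = p)%N by lia.
  have -> : (2 * (p + q) - p - q = p + q)%N by lia.
  by apply: eq_bigr => xi _; rewrite Sh_0n big_set1 heis_perm_top.
rewrite component_heisS ?maxnn ?leqnn ?leq_addr //.
have -> : (2 * p - p - p = 0)%N by lia.
have -> : (p + p - p = p)%N by lia.
have -> : (p - p = 0)%N by lia.
by rewrite Sh_n0 !big_set1 heis_perm_bot.
Qed.
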